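(* Let $K$ be a finite simplicial complex with vertex set $V$ and let $f:V\to\mathbb{R}$ be injective. Let $K'$ be the barycentric subdivision of $K$, with vertices ordered by the extension $f'$ of $f$. Then $f'$ is discrete smooth on $K'$.
   Context: A finite simplicial complex on a finite nonempty vertex set $V$ is a family of subsets of $V$ (simplices) containing all singletons and closed under taking subsets. $\sigma\prec\tau$ (or $\tau\succ\sigma$) means $\sigma\subset\tau$ and $|\tau|=|\sigma|+1$. Barycentric subdivision: $K'$ has one vertex $b(\sigma)$ for each nonempty simplex $\sigma\in K$; its simplices are the sets $\{b(\sigma_0),\dots,b(\sigma_p)\}$ for chains $\sigma_0\subsetneq\sigma_1\subsetneq\dots\subsetneq\sigma_p$ of nonempty simplices of $K$ (together with the empty simplex). Extension: $f'(b(\sigma)):=f(\sigma)$, where $f(\sigma)=\{f(v):v\in\sigma\}$ and these sets are totally ordered lexicographically as follows, for distinct $\sigma_1,\sigma_2$: if $\sigma_1\subsetneq\sigma_2$, then $f(\sigma_1)>f(\sigma_2)$ iff $\min f(\sigma_1)>\max\big(f(\sigma_2)\setminus f(\sigma_1)\big)$ (and otherwise $f(\sigma_1)<f(\sigma_2)$); if neither of $\sigma_1,\sigma_2$ contains the other, then $f(\sigma_1)>f(\sigma_2)$ iff the maximum of the symmetric difference $f(\sigma_1)\,\triangle\,f(\sigma_2)$ belongs to $f(\sigma_1)$. For example, for a triangle with $f(a)>f(b)>f(c)$: $f(a)>f(ab)>f(abc)>f(ac)>f(b)>f(bc)>f(c)$. Thus $f'$ is an injective map from the vertices of $K'$ to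 a totally ordered set, and only this order matters below. Discrete smoothness: for a simplicial complex $\Delta$ with vertex set $W$ and an injective function $g$ from $W$ to a totally ordered set, for $\Sigma\in\Delta$ let $H(\Sigma)=\{w\in W:\ w\in\Sigma,\text{ or } w\notin\Sigma\text{ and }\Sigma\cup\{w\}\in\Delta\}$ and let $h_g(\Sigma)$ be the element of $H(\Sigma)$ with the smallest $g$-value. A simplex $\Sigma\in\Delta$ is discrete smooth if: whenever $h_g(\Sigma)\in\Sigma$, then for all $T\succ\Sigma$ in $\Delta$ one has $h_g(T\setminus\{h_g(\Sigma)\})=h_g(\Sigma)$. The function $g$ is discrete smooth on $\Delta$ if every simplex of $\Delta$ is discrete smooth. *)

(* Defs.v *)
From HB Require Import structures.
From mathcomp Require Import all_boot all_order all_algebra.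
From mathcomp Require Import finmap reals.

Set Implicit Arguments.
Unset Strict Implicit.
Unset Printing Implicit Defensive.

Import Order.TTheory.

(* The vertex set is the whole of [V]. *)
Record complex (V : finType) := Complex {
  simplices :> {set {set V}};
  vertices_neq0 : 0 < #|V|;
  complex1 : forall v, [set v] \in simplices;
  complexS : forall s t : {set V},
    t \in simplices -> s \subset t -> s \in simplices
}.

Definition cofacet (V : finType) (s t : {set V}) : bool :=
  (s \subset t) && (#|t| == #|s|.+1).

Definition bvertex (V : finType) (K : complex V) : finType :=
  {s : {set V} | (s \in K) && (s != set0)}.

Definition bproper (V : finType) (K : complex V) : rel (bvertex K) :=
  fun a b => val a \proper val b.

(* A strictly increasing chain listing the elements of S has exactly #|S|
   members, hence the bounded quantification. *)
Definition subdivision_set (V : finType) (K : complex V) :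
    {set {set bvertex K}} :=
  [set S : {set bvertex K} | [exists c : #|S|.-tuple (bvertex K),
     sorted (@bproper V K) c && (S == [set x in c])]].

Lemma bvertex_card_gt0 (V : finType) (K : complex V) : 0 < #|bvertex K|.
Proof.
have /card_gt0P[v _] := vertices_neq0 K.
have sP : ([set v] \in K) && ([set v] != set0).
  by rewrite complex1 -card_gt0 cards1.
by apply/card_gt0P; exists (exist _ [set v] sP).
Qed.

Lemma bproper_trans (V : finType) (K : complex V) :
  transitive (@bproper V K).
Proof. by move=> b a c; apply: proper_trans. Qed.

Lemma bproper_irr (V : finType) (K : complex V) :
  irreflexive (@bproper V K).
Proof. by move=> a; rewrite /bproper properxx. Qed.

Lemma subdivision_setP (V : finType) (K : complex V) (S : {set bvertex K}) :
  reflect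
    (exists2 c : seq (bvertex K),
       sorted (@bproper V K) c & S = [set x in c])
    (S \in subdivision_set K).
Proof.
rewrite inE; apply: (iffP existsP) => [[c /andP[cs /eqP Sc]]|[c cs Sc]].
  by exists c.
have szc : size c == #|S|.
  rewrite Sc cardsE; apply/eqP/esym/card_uniqP.
  exact: sorted_uniq (@bproper_trans V K) (@bproper_irr V K) _ cs.
by exists (Tuple szc); rewrite /= cs; apply/eqP.
Qed.

Lemma subdivision1 (V : finType) (K : complex V) (a : bvertex K) :
  [set a] \in subdivision_set K.
Proof.
by apply/subdivision_setP; exists [:: a] => //; apply/setP=> x; rewrite !inE.
Qed.

Lemma subdivisionS (V : finType) (K : complex V) (S T : {set bvertex K}) :
  T \in subdivision_set K -> S \subset T -> S \in subdivision_set K.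
Proof.
move=> /subdivision_setP[c cs ->] /subsetP ST; apply/subdivision_setP.
exists [seq x <- c | x \in S].
  exact: sorted_filter (@bproper_trans V K) _ _ cs.
apply/setP=> x; rewrite inE mem_filter.
by case: (boolP (x \in S)) => // /ST; rewrite inE => ->.
Qed.

Definition subdivision (V : finType) (K : complex V) : complex (bvertex K) :=
  Complex (bvertex_card_gt0 K) (@subdivision1 V K) (@subdivisionS V K).

Section DiscreteSmooth.
Variables (W : finType) (D : complex W).
Variables (d : Order.disp_t) (T : orderType d) (g : W -> T).

Definition extended_star (S : {set W}) : {set W} :=
  [set w | (w \in S) || (w \notin S) && (w |: S \in D)].

Lemma extended_star_neq0 (S : {set W}) : exists w, w \in extended_star S.
Proof.
case: (set_0Vmem S) => [->|[w wS]]; last by exists w; rewrite inE wS.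
have /card_gt0P[w _] := vertices_neq0 D.
by exists w; rewrite !inE setU0 complex1.
Qed.

(* The [xchoose] element only witnesses that the argmin is over a nonempty
   set. *)
Definition lowest (S : {set W}) : W :=
  [arg min_(w < xchoose (extended_star_neq0 S) in extended_star S) g w]%O.

Definition discrete_smooth_simplex (S : {set W}) : Prop :=
  lowest S \in S ->
  forall U : {set W}, U \in D -> cofacet S U ->
    lowest (U :\ lowest S) = lowest S.

Definition discrete_smooth : Prop :=
  forall S : {set W}, S \in D -> discrete_smooth_simplex S.

End DiscreteSmooth.

Local Open Scope fset_scope.

Section NonemptyFset.
Variable R : realType.

Record nefset := NeFset {
  fset_of :> {fset R};
  fset_of_neq0 : fset_of != fset0
}.

HB.instance Definition _ := [isSub for fset_of].
HB.instance Definition _ := [Choice of nefset by <:].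

(* Both are 0 on the empty set; they are only meaningful on nonempty ones. *)
Definition fset_min (A : {fset R}) : R := head 0%R (sort <=%O A).
Definition fset_max (A : {fset R}) : R := head 0%R (sort >=%O A).

(* [lex_lt B A] is B < A. When B is a proper subset of A, it is the negation of
   the rule that decides A < B. *)
Definition lex_lt (B A : {fset R}) : bool :=
  if A `<` B then (fset_max (B `\` A) < fset_min A)%R
  else if B `<` A then ~~ (fset_max (A `\` B) < fset_min B)%R
  else (A != B) && (fset_max ((A `\` B) `|` (B `\` A)) \in A).

Definition nefset_lt (B A : nefset) : bool := lex_lt B A.

Definition nefset_le (B A : nefset) : bool := (B == A) || nefset_lt B A.

Lemma fset_maxP (A : {fset R}) : A != fset0 ->
  fset_max A \in A /\ {in A, forall x, (x <= fset_max A)%O}.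
Proof.
move=> A0; rewrite /fset_max.
have : perm_eq (sort >=%O A) A by rewrite perm_sort.
have: sorted >=%O (sort >=%O A) by apply: sort_sorted => x y; apply: le_total.
case: (sort _ _) => [_ /perm_mem e|m s /= ps /perm_mem e].
  by case/fset0Pn: A0 => x; rewrite -e.
split; first by rewrite -e mem_head.
move=> x; rewrite -e inE => /predU1P[->//|xs].
exact: (allP (order_path_min (rev_trans le_trans) ps)).
Qed.

Lemma fset_minP (A : {fset R}) : A != fset0 ->
  fset_min A \in A /\ {in A, forall x, (fset_min A <= x)%O}.
Proof.
move=> A0; rewrite /fset_min.
have : perm_eq (sort <=%O A) A by rewrite perm_sort.
have: sorted <=%O (sort <=%O A) by apply: sort_sorted => x y; apply: le_total.
case: (sort _ _) => [_ /perm_mem e|m s /= ps /perm_mem e].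
  by case/fset0Pn: A0 => x; rewrite -e.
split; first by rewrite -e mem_head.
move=> x; rewrite -e inE => /predU1P[->//|xs].
exact: (allP (order_path_min le_trans ps)).
Qed.

Lemma fset_max_lt_min (A B : {fset R}) : A != fset0 -> B != fset0 ->
  reflect {in B & A, forall b a, (b < a)%O} (fset_max B < fset_min A)%O.
Proof.
move=> /fset_minP[mA leA] /fset_maxP[mB leB].
apply: (iffP idP) => [lt b a bB aA|]; last exact.
exact: le_lt_trans (leB _ bB) (lt_le_trans lt (leA _ aA)).
Qed.

(* B < A iff, at the largest m on which A and B differ, either m is in A and B
   goes on below m, or m is in B and A stops above m. *)
Definition lex_at (m : R) (B A : {fset R}) : Prop :=
  (forall x, (m < x)%O -> (x \in A) = (x \in B)) /\
  ((m \in A /\ m \notin B /\ exists2 b, b \in B & (b < m)%O) \/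
   (m \in B /\ m \notin A /\ {in A, forall a, (m < a)%O})).

Lemma nefset_lt_irr : irreflexive nefset_lt.
Proof. by move=> A; rewrite /nefset_lt /lex_lt fproperEneq eqxx. Qed.

Lemma lex_total (A B : {fset R}) : A != B -> lex_lt A B || lex_lt B A.
Proof.
move=> nAB; rewrite /lex_lt.
case: (boolP (B `<` A)) => BA.
  have -> : A `<` B = false.
    by apply/negbTE; rewrite fproperE negb_and (fproper_sub BA) orbT.
  exact: orbN.
case: (boolP (A `<` B)) => AB; first exact: orNb.
rewrite eq_sym nAB [in X in _ || X]fsetUC /=.
have nz : (B `\` A) `|` (A `\` B) != fset0.
  apply: contraNneq nAB => /eqP; rewrite fsetU_eq0 !fsetD_eq0 => /andP[s1 s2].
  by rewrite eqEfsubset s1 s2.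
have [+ _] := fset_maxP nz; rewrite in_fsetU !in_fsetD.
by case/orP=> /andP[_ ->]; rewrite ?orbT.
Qed.

Lemma lex_atP (A B : {fset R}) : A != fset0 -> B != fset0 ->
  reflect (exists m, lex_at m B A) (lex_lt B A).
Proof.
have dpos (X Y : {fset R}) : X `<` Y -> Y `\` X != fset0.
  by rewrite fproperE fsetD_eq0 => /andP[].
have half (X Y : {fset R}) : X != fset0 -> Y != fset0 ->
    lex_lt Y X -> exists m, lex_at m Y X.
  move=> X0 Y0; rewrite /lex_lt; case: ifP => [XY|nXY].
    have Dn := dpos _ _ XY; have [mD leD] := fset_maxP Dn.
    move=> /(fset_max_lt_min X0 Dn) lt.
    move: (mD); rewrite inE => /andP[mX mY].
    exists (fset_max (Y `\` X)); split=> [x mx|]; last first.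
      by right; do 2!split=> //; move=> a; apply: lt.
    case: (boolP (x \in X)) => [/(fsubsetP (fproper_sub XY)) ->//|xX].
    case: (boolP (x \in Y)) => // xY.
    by have := leD x; rewrite inE xX xY leNgt mx => /(_ isT).
  case: ifP => [YX|nYX].
    have Dn := dpos _ _ YX; have [mD leD] := fset_maxP Dn.
    have [mB leB] := fset_minP Y0.
    rewrite -leNgt => le.
    move: (mD); rewrite inE => /andP[mY mX].
    exists (fset_max (X `\` Y)); split=> [x mx|]; last first.
      left; do 2!split=> //; exists (fset_min Y) => //.
      by rewrite lt_neqAle le andbT; apply: contraNneq mY => <-.
    case: (boolP (x \in Y)) => [/(fsubsetP (fproper_sub YX)) ->//|xY].
    case: (boolP (x \in X)) => // xX.
    by have := leD x; rewrite inE xX xY leNgt mx => /(_ isT).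
  case/andP=> nE mX; set D := _ `|` _ in mX.
  have nsub : ~~ (Y `<=` X).
    apply: contraFN nYX => YX; rewrite fproperEneq YX andbT.
    by rewrite eq_sym.
  have Dn : D != fset0 by rewrite fsetU_eq0 !fsetD_eq0 (negbTE nsub) andbF.
  have [mD leD] := fset_maxP Dn.
  have mY : fset_max D \notin Y.
    by move: mD; rewrite {2}/D !inE mX andbT /= orbF.
  exists (fset_max D); split=> [x mx|].
    have xD : x \notin D by apply: contraL mx => /leD; rewrite leNgt.
    move: xD; rewrite !inE.
    by case: (x \in X); case: (x \in Y).
  left; do 2!split=> //.
  case/fsubsetPn: nsub => b bY bX; exists b => //.
  have := leD b; rewrite !inE bX bY orbT => /(_ isT) bm.
  by rewrite lt_neqAle bm andbT; apply: contraNneq mY => <-.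
have asym (X Y : {fset R}) m n : lex_at m X Y -> lex_at n Y X -> False.
  move=> [em hm] [en hn]; case: (ltgtP m n) => mn.
  - by have := em _ mn; case: hn => -[-> [/negbTE-> _]].
  - by have := en _ mn; case: hm => -[-> [/negbTE-> _]].
  rewrite -{n}mn in en hn.
  case: hm => -[h1 [h2 h3]]; case: hn => -[h4 [h5 h6]].
  - by rewrite h4 in h2.
  - by case: h3 => b bX bm; have := h6 _ bX; rewrite ltNge (ltW bm).
  - by case: h6 => b bX bm; have := h3 _ bX; rewrite ltNge (ltW bm).
  - by rewrite h4 in h2.
move=> A0 B0; apply: (iffP idP) => [|[m hm]]; first exact: half.
have [e|nE] := eqVneq A B.
  by rewrite e in hm; case: hm => _ [] [-> []].
case/orP: (lex_total nE) => // /(half _ _ B0 A0)[n hn].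
by case: (asym _ _ _ _ hm hn).
Qed.

Lemma nefset_lt_trans : transitive nefset_lt.
Proof.
move=> [B B0] [C C0] [A A0]; rewrite /nefset_lt /=.
move=> /(lex_atP B0 C0)[n [en hn]] /(lex_atP A0 B0)[m [em hm]].
apply/(lex_atP A0 C0).
case: (ltgtP m n) => mn.
- exists n; split=> [x nx|]; first by rewrite em ?en // (lt_trans mn).
  rewrite (em _ mn); case: hn => [?|[nC [nB Ba]]]; first by left.
  right; split=> //; split=> // a aA.
  case: hm => [[_ [_ [b bB bm]]]|[mB _]]; last first.
    by have := Ba _ mB; rewrite ltNge (ltW mn).
  by have := Ba _ bB; rewrite ltNge (ltW (lt_trans bm mn)).
- exists m; split=> [x mx|]; first by rewrite em // en // (lt_trans mn).
  rewrite -(en _ mn); case: hm => [[mA [mB [b bB bm]]]|?]; last by right.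
  left; do 2!split=> //.
  case: hn => [[_ [_ [c cC cn]]]|[nC _]]; last by exists n.
  by exists c => //; apply: lt_trans mn.
rewrite -{n}mn in en hn.
case: hm => [[mA [mB [b bB bm]]]|[mB [mA Am]]].
  case: hn => [[]|[mC [_ Bm]]]; first by rewrite (negbTE mB).
  by have := Bm _ bB; rewrite ltNge (ltW bm).
case: hn => [[_ [mC [c cC cm]]]|[_ []]]; last by rewrite mB.
have AC : A `<` C.
  rewrite fproperE; apply/andP; split.
    by apply/fsubsetP=> a aA; rewrite -en ?Am // -em ?Am.
  by apply/fsubsetPn; exists c => //; apply/negP => /Am; rewrite ltNge (ltW cm).
apply/(lex_atP A0 C0); rewrite /lex_lt AC.
apply/fset_max_lt_min => //.
  by move: AC; rewrite fproperE fsetD_eq0 => /andP[].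
move=> x a; rewrite inE => /andP[xA xC] /Am; apply: le_lt_trans.
by rewrite leNgt; apply: contra xA => mx; rewrite em // en.
Qed.

Lemma nefset_lt_total (A B : nefset) : A != B -> nefset_lt A B || nefset_lt B A.
Proof. exact: lex_total. Qed.

Fact nefset_display : Order.disp_t. Proof. exact: Order.Disp tt tt. Qed.

HB.instance Definition _ := Order.LtOrder.Build nefset_display nefset
  (fun (A B : nefset) => erefl (nefset_le A B))
  (fun _ _ => erefl) (fun _ _ => erefl)
  nefset_lt_irr nefset_lt_trans nefset_lt_total.

End NonemptyFset.

Section Extension.
Variables (R : realType) (V : finType) (K : complex V) (f : V -> R).

Lemma extension_neq0 (a : bvertex K) : [fset f v | v in val a] != fset0.
Proof.
have /andP[_ /set0Pn[v va]] := valP a.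
by apply/fset0Pn; exists (f v); apply: in_imfset.
Qed.

Definition extension (a : bvertex K) : nefset R := NeFset (extension_neq0 a).

Lemma extension_inj : injective f -> injective extension.
Proof.
move=> fI a b /(congr1 (@fset_of R)) /= e; apply/val_inj/setP=> v.
have := congr1 (fun A : {fset R} => f v \in A) e.
by rewrite !mem_imfset.
Qed.

End Extension.

(* Main.v *)
Require Import Defs.
From mathcomp Require Import all_boot all_order all_algebra.
From mathcomp Require Import finmap reals.

Set Implicit Arguments.
Unset Strict Implicit.
Unset Printing Implicit Defensive.

Import Order.TTheory.

(* A simplex of K' is a chain S of simplices of K.  Suppose that h, the lowest
   element of the extended star of S, belongs to S.  If two consecutive members
   a < b of the chain (or the empty set and its bottom) lie below h, then
   a + {min b} is in the extended star and is lower than h unless it equals b;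
   so S contains a full flag up to h, and h = a + {min h} for its predecessor
   a.  Hence the vertex t added to S lies above h.  Let c be the smallest member
   of S + {t} above h: adding a vertex of c to h does not go lower, so min h is
   the minimum of c.  An element x of the extended star of S + {t} - {h} that is
   incomparable with h lies between a and c and misses min h, so it is obtained
   from a by adding vertices higher than min h, and it is higher than h. *)

(** * The lowest element of an extended star *)

Section Lowest.
Variables (W : finType) (D : complex W).
Variables (d : Order.disp_t) (T : orderType d) (g : W -> T).

Lemma extended_starE (S : {set W}) (w : W) :
  S \in D -> (w \in extended_star D S) = (w |: S \in D).
Proof.
move=> SD; rewrite inE; case: (boolP (w \in S)) => //= wS.
by rewrite setUC (setUidPl _) ?SD // sub1set.
Qed.

Lemma lowest_le (S : {set W}) (w : W) :
  w \in extended_star D S -> (g (lowest D g S) <= g w)%O.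
Proof.
rewrite /lowest; case: Order.TotalTheory.arg_minP => [|i _ + wS]; last exact.
exact: xchooseP.
Qed.

Lemma lowest_in (S : {set W}) : lowest D g S \in extended_star D S.
Proof.
rewrite /lowest; case: Order.TotalTheory.arg_minP => //.
exact: xchooseP.
Qed.

Lemma lowest_eq (S : {set W}) (w : W) : injective g ->
  w \in extended_star D S ->
  {in extended_star D S, forall x, (g w <= g x)%O} -> lowest D g S = w.
Proof.
move=> gI wS wle; apply/gI/le_anti.
by rewrite lowest_le //= wle // lowest_in.
Qed.

End Lowest.

(** * Simplices of the subdivision as families of pairwise nested sets *)

Lemma subdivisionP (V : finType) (K : complex V) (S : {set bvertex K}) :
  reflect {in S &, forall a b : bvertex K,
             (val a \subset val b) || (val b \subset val a)}
    (S \in subdivision K).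
Proof.
apply: (iffP (subdivision_setP S)) => [[c cs ->] a b|chain].
  rewrite !inE => ac bc.
  have le_tr : transitive (fun a b : bvertex K => val a \subset val b).
    by move=> y x z; apply: subset_trans.
  have {}cs : sorted (fun a b : bvertex K => val a \subset val b) c.
    by apply: sub_sorted cs => x y /proper_sub.
  case: (ltngtP (index a c) (index b c)) => ab.
  - by rewrite (sorted_ltn_index le_tr cs a b).
  - by rewrite (sorted_ltn_index le_tr cs b a) ?orbT.
  - by rewrite -(nth_index a ac) ab nth_index // subxx.
(* Sorting by cardinality gives a strictly increasing list, since nested sets of equal size
   coincide. *)
pose le := fun a b : bvertex K => #|val a| <= #|val b|.
have le_tr : transitive le by move=> y x z; apply: leq_trans.
exists (sort le (enum S)); last first.
  by apply/setP=> x; rewrite inE mem_sort mem_enum.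
rewrite (sorted_pairwise (@bproper_trans V K)).
have : pairwise (fun a b => le a b && (a != b)) (sort le (enum S)).
  rewrite (pairwise_relI le (fun a b => a != b)) -(sorted_pairwise le_tr).
  rewrite sort_sorted; last by move=> x y; apply: leq_total.
  by rewrite -uniq_pairwise sort_uniq enum_uniq.
apply: (sub_in_pairwise (P := mem S)); last first.
  by apply/allP => x; rewrite mem_sort mem_enum.
move=> a b aS bS /andP[ab nab]; rewrite /bproper properEneq val_eqE nab.
case/orP: (chain _ _ aS bS) => // ba.
have /eqP/val_inj e : val b == val a by rewrite eqEcard ba.
by rewrite e eqxx in nab.
Qed.

Lemma extended_star_subdivision (V : finType) (K : complex V)
    (S : {set bvertex K}) (w : bvertex K) : S \in subdivision K ->
  reflect {in S, forall s : bvertex K,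
             (val w \subset val s) || (val s \subset val w)}
    (w \in extended_star (subdivision K) S).
Proof.
move=> SD; rewrite extended_starE //.
apply: (iffP (subdivisionP _)) => [chain s sS|cmp a b].
  by apply: chain; rewrite !inE ?eqxx ?sS ?orbT.
rewrite !inE => /predU1P[->|aS] /predU1P[->|bS].
- by rewrite subxx.
- exact: cmp.
- by rewrite orbC cmp.
- exact: (subdivisionP _ SD).
Qed.

(** * Two criteria for comparing values of the extension *)

Section ExtensionOrder.
Variables (R : realType) (V : finType) (K : complex V) (f : V -> R).
Hypothesis f_inj : injective f.
Implicit Types a b : bvertex K.

Local Notation ext := (extension (K := K) f).

Lemma mem_extension a v : (f v \in fset_of (ext a)) = (v \in val a).
Proof. by rewrite /= mem_imfset. Qed.

Lemma extension_ltP a b (v : V) : lex_at (f v) (ext a) (ext b) ->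
  (ext a < ext b)%O.
Proof.
move=> h; apply: (introT (lex_atP (fset_of_neq0 _) (fset_of_neq0 _))).
by exists (f v).
Qed.

(** Reals outside the image of [f] lie in neither set, so agreement need only be tested on
    vertices. *)
Lemma extension_agree a b (v : V) :
  (forall w, (f v < f w)%O -> (w \in val b) = (w \in val a)) ->
  forall x, (f v < x)%O ->
  (x \in fset_of (ext b)) = (x \in fset_of (ext a)).
Proof.
move=> ab x vx; apply/idP/idP => /imfsetP[w /= wa e]; subst x.
  by rewrite mem_extension -ab.
by rewrite mem_extension ab.
Qed.

(** The highest vertex [v] of [val b :\: val a] decides: it lies above [n], the only vertex of [a]
    that [b] may miss, and [n] shows that [a] goes on below [v]. As [n] may also lie in [b], nested
    pairs are covered too. *)
Lemma extension_lt_above a b (n q : V) :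
    n \in val a -> q \in val b -> q \notin val a -> (f n < f q)%O ->
    (forall w, w \in val a -> w \notin val b -> w = n) ->
  (ext a < ext b)%O.
Proof.
move=> na qb qa nq ab.
have qP : q \in val b :\: val a by rewrite inE qa.
case: (Order.TotalTheory.arg_maxP f qP) => v /setDP[vb va] vmax.
have nv : (f n < f v)%O by apply: lt_le_trans (vmax _ qP).
apply: (@extension_ltP _ _ v); split.
  apply: extension_agree => w vw; apply/idP/idP => [wb|wa].
    by apply: contraTT vw => wa; rewrite -leNgt; apply: vmax; apply/setDP.
  by apply: contraTT vw => /(ab _ wa) ->; rewrite -leNgt ltW.
left; rewrite !mem_extension; do 2!split=> //.
by exists (f n); rewrite ?mem_extension.
Qed.

(** The two sets first differ, from the top, at [y], and [b] stops above it. *)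
Lemma extension_lt_below a b (y : V) : val a = y |: val b ->
  {in val b, forall v, (f y < f v)%O} -> (ext a < ext b)%O.
Proof.
move=> ab yb; apply: (@extension_ltP _ _ y); split.
  apply: extension_agree => w yw; rewrite ab !inE.
  by case: eqVneq yw => // ->; rewrite ltxx.
right; rewrite !mem_extension ab setU11; do 2!split=> //.
  by apply/negP => /yb; rewrite ltxx.
by move=> _ /imfsetP[v /= vb ->]; apply: yb.
Qed.

End ExtensionOrder.

(** * Neighbours of a set in a chain *)

Section Chain.
Variables (V : finType) (K : complex V) (S : {set bvertex K}).
Hypothesis SD : S \in subdivision K.

(** [P] is a bare set because the empty set, which has no barycentre, stands in when no member of
    [S] lies below [t]. *)
Lemma chain_pred (t : {set V}) : exists P : {set V},
  [/\ P \subset t, P = set0 \/ exists2 s, s \in S & val s = P /\ val s \proper t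
    & {in S, forall s : bvertex K, val s \proper t -> val s \subset P}].
Proof.
case: (pickP [pred s in S | val s \proper t]) => [s0 s0P|none]; last first.
  exists set0; split; [exact: sub0set|by left|] => s sS st.
  by have := none s; rewrite /= sS st.
case: (arg_maxnP (fun s : bvertex K => #|val s|) s0P) => a /andP[aS aP] amax.
exists (val a); split; [exact: proper_sub|by right; exists a|] => s sS st.
case/orP: (subdivisionP _ SD _ _ sS aS) => // sub.
have := amax s; rewrite /= sS st => /(_ isT) le.
by have /eqP -> : val a == val s by rewrite eqEcard sub.
Qed.

Lemma chain_succ (t : {set V}) (s0 : bvertex K) :
  s0 \in S -> t \proper val s0 ->
  exists2 c, c \in S & t \proper val c /\
    {in S, forall s : bvertex K, t \proper val s -> val c \subset val s}.
Proof.
move=> s0S ts0.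
have s0P : [pred s in S | t \proper val s] s0 by rewrite /= s0S.
case: (arg_minnP (fun s : bvertex K => #|val s|) s0P) => a /andP[aS aP] amin.
exists a => //; split=> // s sS st.
case/orP: (subdivisionP _ SD _ _ aS sS) => // sub.
have := amin s; rewrite /= sS st => /(_ isT) le.
by have /eqP -> : val s == val a by rewrite eqEcard sub.
Qed.

End Chain.

Lemma bvertex_of (V : finType) (K : complex V) (s : {set V}) (v : V) :
  s \in K -> v \in s -> exists a : bvertex K, val a = s.
Proof.
move=> sK vs; have sP : (s \in K) && (s != set0).
  by rewrite sK; apply/set0Pn; exists v.
by exists (exist _ s sP).
Qed.

Lemma bvertex_simplex (V : finType) (K : complex V) (a : bvertex K) :
  val a \in K.
Proof. by case/andP: (valP a). Qed.

(** * Chains that contain the lowest element of their extended star *)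

Section Smooth.
Variables (R : realType) (V : finType) (K : complex V) (f : V -> R).
Hypothesis f_inj : injective f.
Variables (S : {set bvertex K}) (h : bvertex K).
Hypothesis SD : S \in subdivision K.
Hypothesis hS : h \in S.
Hypothesis h_le : {in extended_star (subdivision K) S, forall y,
  (extension f h <= extension f y)%O}.

(** The set [n |: P] is nested with every member of [S], so it is not lower than [h]. A vertex [q]
    of [b] outside it would be higher than [n] and belong to [h], which would make it lower. *)
Lemma gap_below (P b : {set V}) (n : V) :
    P \subset b -> b \subset val h ->
    {in S, forall s : bvertex K, (val s \subset P) || (b \subset val s)} ->
    n \in b -> {in b, forall v, (f n <= f v)%O} ->
  b = n |: P.
Proof.
move=> Pb bh PbS nb nmin; apply/eqP.
have nPb : n |: P \subset b by rewrite subUset sub1set nb.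
have nPh := subset_trans nPb bh.
rewrite eqEsubset nPb andbT; apply/subsetP=> q qb.
have [y yE] := bvertex_of (complexS (bvertex_simplex h) nPh) (setU11 n P).
have /h_le : y \in extended_star (subdivision K) S.
  apply/extended_star_subdivision => // s /PbS /orP[sP|bs]; rewrite yE.
    by rewrite (subset_trans sP (subsetUr _ _)) orbT.
  by rewrite (subset_trans nPb bs).
apply: contraTT => qy; rewrite -ltNge.
apply: (@extension_lt_above _ _ _ _ f_inj _ _ n q).
- by rewrite yE setU11.
- exact: (subsetP bh).
- by rewrite yE.
- rewrite lt_neqAle nmin // andbT (inj_eq f_inj).
  by apply: contraNneq qy => <-; rewrite setU11.
- by move=> w; rewrite yE => /(subsetP nPh) ->.
Qed.

Lemma bvertex_argmin (a : bvertex K) :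
  exists2 n, n \in val a & {in val a, forall w, (f n <= f w)%O}.
Proof.
have /andP[_ /set0Pn[v va]] := valP a.
by case: (Order.TotalTheory.arg_minP f va) => n na nmin; exists n.
Qed.

(** If [t] were missing, it would lie strictly between its neighbours [P] and [c], but [c = n |: P]
    leaves no room. *)
Lemma full_below (t : bvertex K) :
  t \in extended_star (subdivision K) S -> val t \proper val h -> t \in S.
Proof.
move=> /(extended_star_subdivision _ SD) tS th.
apply: contraT => tnS.
have [P [Pt PS leP]] := chain_pred SD (val t).
have [c cS [tc cle]] := chain_succ SD hS th.
have [n nc nmin] := bvertex_argmin c.
have cE : val c = n |: P.
  apply: gap_below nc nmin.
  - exact: subset_trans (proper_sub tc).
  - exact: cle.
  move=> s sS; have nst : val t != val s.
    by apply: contraNneq tnS => /val_inj ->.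
  case/orP: (tS _ sS) => ts.
    by rewrite cle ?orbT // properEneq nst.
  by rewrite leP // properEneq eq_sym nst.
have Pnt : P != val t.
  case: PS => [->|[s sS [<- _]]]; first by case/andP: (valP t); rewrite eq_sym.
  by apply: contraNneq tnS => /val_inj <-.
have {}Pt : P \proper val t by rewrite properEneq Pnt.
have := proper_card tc; rewrite cE cardsU1.
have := proper_card Pt; case: (n \notin P); rewrite ?add0n ?add1n ?ltnS => p q.
  by have := leq_trans p q; rewrite ltnn.
by have := ltn_trans p q; rewrite ltnn.
Qed.

Variable t : bvertex K.
Hypothesis UD : t |: S \in subdivision K.
Hypothesis tS : t \notin S.

Lemma lowest_above (x : bvertex K) :
    {in (t |: S) :\ h, forall s : bvertex K,
      (val x \subset val s) || (val s \subset val x)} ->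
  (extension f h <= extension f x)%O.
Proof.
move=> xU.
(* When [x] is nested with [h], it is nested with all of [S], and minimality of [h] applies. *)
have [xh|] := boolP ((val x \subset val h) || (val h \subset val x)).
  apply: h_le; apply/extended_star_subdivision => // s sS.
  by case: (eqVneq s h) => [->//|sh]; apply: xU; rewrite !inE sh sS orbT.
rewrite negb_or => /andP[nxh nhx].
have tstar : t \in extended_star (subdivision K) S by rewrite extended_starE.
have ht : val h \proper val t.
  have nht : h != t by apply: contraNneq tS => <-.
  have := extended_star_subdivision _ SD tstar _ hS.
  case/orP=> th; last by rewrite properEneq val_eqE nht.
  case/negP: tS; apply: full_below => //.
  by rewrite properEneq val_eqE eq_sym nht.
have [P [Ph PS leP]] := chain_pred SD (val h).
(* The successor of [h] is sought in [t |: S], where [t] ensures that it exists; it may be [t]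
   itself. *)
have [c cU [hc cle]] := chain_succ UD (setU11 t S) ht.
have [n nh nmin] := bvertex_argmin h.
have cmp_h (s : bvertex K) : s \in S -> s != h ->
    (val s \proper val h) || (val h \proper val s).
  move=> sS sh; have := subdivisionP _ SD _ _ sS hS.
  by rewrite !properEneq !val_eqE sh eq_sym sh.
have hE : val h = n |: P.
  apply: gap_below nh nmin => // s sS.
  case: (eqVneq s h) => [->|sh]; first by rewrite subxx orbT.
  by case/orP: (cmp_h s sS sh) => [/leP->//|/proper_sub->]; rewrite orbT.
have Px : P \subset val x.
  case: PS => [->|[s sS [<- sh]]]; first exact: sub0set.
  have /xU : s \in (t |: S) :\ h.
    rewrite !inE sS orbT andbT; apply: contraTneq sh => ->.
    by rewrite properxx.
  case/orP=> // xs; case/negP: nxh; exact: subset_trans (proper_sub sh).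
have xc : val x \subset val c.
  have /xU : c \in (t |: S) :\ h.
    rewrite in_setD1 cU andbT; apply: contraTneq hc => ->.
    by rewrite properxx.
  case/orP=> // cx; case/negP: nhx; exact: subset_trans (proper_sub hc) cx.
have nx : n \notin val x.
  by apply: contra nhx => nx; rewrite hE subUset sub1set nx.
case/subsetPn: nxh => y yx yh.
have hyc : y |: val h \subset val c.
  by rewrite subUset sub1set (subsetP xc) // proper_sub.
(* Otherwise [y] would be lower than every vertex of [h], and [y |: val h], which fits between [h]
   and [c], would be lower than [h]. *)
have ny : (f n < f y)%O.
  have [z zE] := bvertex_of (complexS (bvertex_simplex c) hyc) (setU11 y _).
  have /h_le : z \in extended_star (subdivision K) S.
    apply/extended_star_subdivision => // s sS; rewrite zE.
    case: (eqVneq s h) => [->|sh]; first by rewrite subsetUr orbT.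
    case/orP: (cmp_h s sS sh) => [|hs].
      by move=> /proper_sub/subset_trans -> //; rewrite ?subsetUr ?orbT.
    by rewrite (subset_trans hyc) // cle // inE sS orbT.
  apply: contraTT; rewrite -leNgt -ltNge => yn.
  apply: extension_lt_below zE _ => // v vh.
  apply: lt_le_trans (nmin _ vh); rewrite lt_neqAle yn andbT (inj_eq f_inj).
  by apply: contraNneq yh => ->.
(* [n] is the only vertex of [h] missing from [x], while [y] lies in [x] only and is higher. *)
apply/ltW/(@extension_lt_above _ _ _ _ f_inj _ _ n y) => // w.
by rewrite hE !inE => /predU1P[//|/(subsetP Px) ->].
Qed.

End Smooth.

Theorem theorem26 (R : realType) (V : finType) (K : complex V) (f : V -> R)
    (f_inj : injective f) :
  discrete_smooth (subdivision K) (extension (K := K) f).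
Proof.
move=> S SD hS U UD /andP[SU /eqP cardU].
have h_le := @lowest_le _ (subdivision K) _ _ (extension (K := K) f) S.
move: (lowest _ _ _) hS h_le => h hS h_le.
have [t UE tS] : exists2 t, U = t |: S & t \notin S.
  have /cards1P[t tE] : #|U :\: S| == 1.
    by rewrite cardsD (setIidPr SU) cardU subSnn.
  exists t; last by have := set11 t; rewrite -tE => /setDP[].
  by rewrite -tE setUC setDE setUIr setUCr setIT (setUidPr SU).
have hU : h \in U by apply: (subsetP SU).
have UhD : U :\ h \in subdivision K := complexS UD (subD1set _ _).
(* [h] is in the extended star of [U :\ h] because adding it back gives [U]. *)
apply: lowest_eq; first exact: extension_inj.
  by rewrite extended_starE // setD1K.
move=> x /(extended_star_subdivision _ UhD).
by rewrite UE; apply: lowest_above; rewrite -?UE.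
Qed.
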